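(* Let $t\ge1$ be an integer, let $b_t(n)$ denote the number of $t$-core partitions of $n$, and for $n\ge1$ set $$a^{(t)}(n)=\sigma_1(n)-t^2\sigma_1^{(t)}(n),\qquad \sigma_1^{(t)}(n)=\begin{cases}\sigma_1(n/t), & t\mid n,\\ 0, & \text{otherwise.}\end{cases}$$ Then for every integer $n\ge1$, $$b_t(n)=\frac{1}{n!}B_n\big(0!\,a^{(t)}(1),\,1!\,a^{(t)}(2),\,\ldots,\,(n-1)!\,a^{(t)}(n)\big),$$ equivalently $$b_t(n)=\sum_{\beta=(1^{m_1},\ldots,n^{m_n})\vdash n}\ \prod_{j=1}^n\frac{1}{m_j!}\Big(\frac{a^{(t)}(j)}{j}\Big)^{m_j},$$ and conversely $$a^{(t)}(n)=n\sum_{\beta=(1^{m_1},\ldots,n^{m_n})\vdash n}(-1)^{\ell(\beta)-1}(\ell(\beta)-1)!\prod_{j=1}^n\frac{b_t(j)^{m_j}}{m_j!}.$$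
   Context: A $t$-core partition is a partition none of whose hook numbers is divisible by $t$; the generating function (a known result) is $\sum_{n\ge0}b_t(n)q^n=\prod_{n\ge1}\frac{(1-q^{tn})^t}{1-q^n}$. Here $\sigma_1(n)=\sum_{d\mid n}d$. The complete Bell polynomials $B_n(Y_1,\ldots,Y_n)$ are defined by $$\sum_{n=0}^\infty B_n(Y_1,\ldots,Y_n)\frac{u^n}{n!}=\exp\Big(\sum_{j=1}^\infty Y_j\frac{u^j}{j!}\Big).$$ A partition $\beta$ of $n$ is written $\beta=(1^{m_1},\ldots,n^{m_n})\vdash n$, where $m_j\ge0$ is the multiplicity of the part $j$ (so $\sum_j j\,m_j=n$), and $\ell(\beta)=m_1+\cdots+m_n$. *)

(* Defs.v *)
From mathcomp Require Import all_boot all_order all_algebra mpoly.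

Set Implicit Arguments.
Unset Strict Implicit.
Unset Printing Implicit Defensive.

Import GRing.Theory.

Definition is_partition (n : nat) (la : seq nat) : bool :=
  [&& sorted geq la, 0 \notin la & sumn la == n].

(* la'_j, the j-th part of the conjugate partition, with j counted from 0. *)
Definition conj_part (la : seq nat) (j : nat) : nat :=
  count (fun p => j < p) la.

(* Cells (i, j), with rows and columns counted from 0, satisfy
   i < size la and j < nth 0 la i; the hook number is arm + leg + 1. *)
Definition hook (la : seq nat) (i j : nat) : nat :=
  (nth 0 la i - j.+1) + (conj_part la j - i.+1) + 1.

Definition is_core (t : nat) (la : seq nat) : bool :=
  all (fun i => all (fun j => ~~ (t %| hook la i j)) (iota 0 (nth 0 la i)))
      (iota 0 (size la)).

(* A partition of n has at most n parts, each at most n, so all of them occur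
   among the sequences of length at most n over {0, ..., n}. *)
Definition num_cores (t n : nat) : nat :=
  #|[set s : n.-bseq 'I_n.+1 |
      let la := [seq val p | p <- s] in is_partition n la && is_core t la]|.

Definition sigma1 (n : nat) : nat := \sum_(d <- divisors n) d.

Definition sigma1_at (t n : nat) : nat :=
  if t %| n then sigma1 (n %/ t) else 0.

(* A partition (1^{m_1}, ..., n^{m_n}) of n is its family of multiplicities,
   m i being the multiplicity of the part i.+1; multiplicities are at most n. *)
Definition mult_partitions (n : nat) : {set {ffun 'I_n -> 'I_n.+1}} :=
  [set m : {ffun 'I_n -> 'I_n.+1} | \sum_(i < n) i.+1 * m i == n].

Definition mult_length (n : nat) (m : {ffun 'I_n -> 'I_n.+1}) : nat :=
  \sum_(i < n) m i.

Local Open Scope ring_scope.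

Definition coef_a (t n : nat) : rat :=
  (sigma1 n)%:R - (t ^ 2)%:R * (sigma1_at t n)%:R.

(* Coefficient of u^n in exp(f(u)) = \sum_k f(u)^k / k!, for a formal power
   series f(u) = \sum_j f j u^j with f 0 = 0: then f^k has no term of degree
   less than k, and the coefficients f j with j > n do not contribute. *)
Definition exp_coef (A : comAlgType rat) (f : nat -> A) (n : nat) : A :=
  \sum_(k < n.+1) (k`!%:R^-1 : rat) *: ((\poly_(j < n.+1) f j) ^+ k)`_n.

(* The series \sum_(j >= 1) Y_j u^j / j!. *)
Definition egf (A : comAlgType rat) (Y : nat -> A) (j : nat) : A :=
  if j is 0 then 0 else (j`!%:R^-1 : rat) *: Y j.

(* Y_1, ..., Y_n as the variables 'X_0, ..., 'X_(n-1) of {mpoly rat[n]}.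
   The Y_j with j > n, set to 0 here, do not contribute to B_n. *)
Definition bell_var (n : nat) (j : nat) : {mpoly rat[n]} :=
  \sum_(i < n | i.+1 == j) 'X_i.

Definition bell (n : nat) : {mpoly rat[n]} :=
  n`!%:R *: exp_coef (egf (bell_var n)) n.

(* The generating function \sum_n B_n(Y_1, ..., Y_n) u^n / n! =
   exp(\sum_(j >= 1) Y_j u^j / j!), with all the Y_j present. *)
Lemma bell_gf (Y : nat -> rat) (n : nat) :
  (bell n).@[fun i : 'I_n => Y i.+1] / n`!%:R
  = exp_coef (egf (Y : nat -> rat^o)) n.
Proof.
have n0 : n`!%:R != 0 :> rat by rewrite Num.Theory.pnatr_eq0 -lt0n fact_gt0.
rewrite /bell mevalZ mulrAC mulfV // mul1r /exp_coef raddf_sum /=.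
apply: eq_bigr => k _; rewrite mevalZ; congr (_ * _).
rewrite -(coef_map (meval (fun i : 'I_n => Y i.+1))) /= rmorphXn /=.
congr (coefp n (_ ^+ k)); apply/polyP => j.
rewrite coef_map /= !coef_poly; case: ltnP => [jn|_]; last exact: meval0.
case: j jn => [|j] jn /=; first exact: meval0.
rewrite mevalZ; congr (_ * _).
rewrite /bell_var (bigD1 (Ordinal (jn : (j < n)%N))) //= big1 ?addr0 ?mevalXU //.
by move=> i /andP[/eqP[ij] /eqP[]]; apply: val_inj.
Qed.

(* Main.v *)
Require Import Defs.
From mathcomp Require Import all_boot all_order all_algebra mpoly.
From mathcomp Require Import zify ring.

(** Encode a partition by the beta-set of its first N parts padded with zeros.
    It is a t-core iff the beta-set is closed under x -> x - t, so t-cores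
    correspond to t-tuples c of runner lengths of the t-abacus with sum N.
    The q-binomial theorem on both sides of
      prod_(i < t K) (1 + z q^i) = prod_(r < t) prod_(y < K) (1 + z q^(r + t y))
    expresses a Gaussian binomial as a sum over such c; since the Gaussian
    binomials involved agree with 1 / prod (1 - q^i) up to order n, this gives
    (sum_m b_t(m) q^m) prod (1 - q^i) = prod (1 - q^(t i))^t modulo q^(n+1).
    Logarithmic differentiation of polynomials modulo q^(n+1) identifies
    a^(t)(j) / j as the coefficients of the logarithm of sum_m b_t(m) q^m, and
    the multinomial expansions of exp and log give the formulas. *)

Set Implicit Arguments.
Unset Strict Implicit.
Unset Printing Implicit Defensive.

(** * Beta-sets of partitions *)

Definition betas (N : nat) (la : seq nat) : seq nat :=
  mkseq (fun i => nth 0 la i + (N - i.+1)) N.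

Lemma size_betas N la : size (betas N la) = N.
Proof. by rewrite size_mkseq. Qed.

Lemma nth_betas N la i : i < N -> nth 0 (betas N la) i = nth 0 la i + (N - i.+1).
Proof. exact: nth_mkseq. Qed.

Lemma betas_cons N l la : betas N.+1 (l :: la) = (l + N) :: betas N la.
Proof. by rewrite /betas /mkseq /= subn1 -[1]addn0 iotaDl -map_comp.
Qed.

Lemma betas_nil N : betas N.+1 [::] = N :: betas N [::].
Proof.
rewrite /betas /mkseq /= subn1 -[1]addn0 iotaDl -map_comp; congr (_ :: _).
by apply: eq_map => i /=; rewrite add1n subSS !nth_nil.
Qed.

(** The shifts N - 1, ..., 1, 0 add up to the triangular number ['C(N, 2)]. *)
Lemma sumn_betas N la : size la <= N -> sumn (betas N la) = sumn la + 'C(N, 2).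
Proof.
elim: N la => [|N IH] [|l la] // H.
  by rewrite betas_nil /= IH // binS bin1 /=; lia.
by rewrite betas_cons /= IH // binS bin1 /=; lia.
Qed.

Lemma sorted_geq_nth la i j : sorted geq la -> i <= j -> nth 0 la j <= nth 0 la i.
Proof.
move=> sla ij; have [jl|jl] := ltnP j (size la); last by rewrite nth_default.
have geq_trans : transitive geq by move=> y x z /= xy yz; apply: leq_trans xy.
apply: (@sorted_leq_nth _ geq geq_trans _ 0 la sla i j _ jl ij).
  by move=> x /=.
exact: leq_ltn_trans ij jl.
Qed.

Lemma sorted_betas N la : sorted geq la -> sorted gtn (betas N la).
Proof.
move=> sla; apply/(sortedP 0) => i; rewrite size_betas => iN.
rewrite !nth_betas; try lia.
have := sorted_geq_nth sla (leqnSn i); rewrite /=; lia.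
Qed.

Lemma eq_nth_pos (la mu : seq nat) :
  0 \notin la -> 0 \notin mu -> (forall i, nth 0 la i = nth 0 mu i) -> la = mu.
Proof.
elim: la mu => [|l la IH] [|m mu] //=; rewrite ?in_cons ?negb_or.
- by move=> _ /andP[m0 _] /(_ 0) /= E; rewrite -E in m0.
- by move=> /andP[m0 _] _ /(_ 0) /= E; rewrite E in m0.
move=> /andP[_ l0] /andP[_ m0] E; have /= -> := E 0; congr (_ :: _).
by apply: IH => // i; apply: (E i.+1).
Qed.

Lemma betas_inj N la mu :
  size la <= N -> size mu <= N -> 0 \notin la -> 0 \notin mu ->
  betas N la = betas N mu -> la = mu.
Proof.
move=> sl sm l0 m0 E; apply: eq_nth_pos => // i.
have [iN|iN] := ltnP i N; last by rewrite !nth_default //; apply: leq_trans iN.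
by apply/eqP; rewrite -(eqn_add2r (N - i.+1)) -!nth_betas // E.
Qed.

(** Induction that strips the largest element x: the corresponding part is x minus the number of
    smaller elements. *)
Lemma betas_surj bs : sorted gtn bs ->
  exists2 la, [/\ sorted geq la, 0 \notin la & size la <= size bs]
            & betas (size bs) la = bs.
Proof.
elim: bs => [|x bs IH] //=; first by exists [::].
move=> xbs; have [la [sla l0 zla] E] := IH (path_sorted xbs).
have hx : if size bs is 0 then true else nth 0 la 0 + (size bs).-1 < x.
  case: bs xbs {IH} zla E => [|y bs] //= /andP[yx _] zla E.
  by move: (congr1 (head 0) E); rewrite /= => H; lia.
(* A zero first part means that the beta-set is an initial segment of the integers, so the partition
   is empty. *)
case: (posnP (x - size bs)) => [x0|xpos].
  have xE : x = size bs by case: (size bs) hx x0 => //; lia.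
  exists [::]; first by [].
  rewrite betas_nil -xE; congr (_ :: _).
  rewrite -{}E xE; congr betas.
  case: la sla l0 zla hx => //= l la _; rewrite in_cons negb_or => /andP[l0 _].
  by case: (size bs) xE => //=; lia.
exists ((x - size bs) :: la).
  split=> //=; last by rewrite in_cons negb_or l0 andbT; lia.
  by case: la sla hx zla {l0 E} => //= l la ->; case: (size bs) xpos => //=; lia.
by rewrite betas_cons E subnK //; lia.
Qed.

(** * Hook numbers as differences of beta numbers and gaps *)

Lemma nth_gt_size la i j : j < nth 0 la i -> i < size la.
Proof. by case: (ltnP i (size la)) => // H; rewrite nth_default. Qed.

(** As the parts decrease, those exceeding j are the first la'_j ones. *)
Lemma nth_gt_count la i j : sorted geq la ->
  (j < nth 0 la i) = (i < conj_part la j).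
Proof.
move=> sla; rewrite /conj_part; elim: la sla i => [|l la IH] sla i /=.
  by rewrite nth_nil.
have [jl|lj] := ltnP j l.
  by case: i => [|i] /=; [rewrite jl | rewrite IH // (path_sorted sla)].
have -> : count (fun p => j < p) la = 0.
  have /allP al : all (geq l) la.
    by apply: order_path_min sla => y x z /= xy yz; apply: leq_trans xy.
  apply/eqP; rewrite -leqn0 leqNgt -has_count; apply/hasPn => y /al /=; lia.
by rewrite addn0 ltn0; have := @sorted_geq_nth _ 0 i sla isT => /=; lia.
Qed.

(* The integers N + j - la'_j are those outside the beta-set. *)
Lemma hook_gap N la i j : sorted geq la -> size la <= N -> j < nth 0 la i ->
  [/\ 0 < hook la i j <= nth 0 (betas N la) i
    & nth 0 (betas N la) i - hook la i j \notin betas N la].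
Proof.
move=> sla zla jl.
have il : i < size la by apply: nth_gt_size jl.
have ic : i < conj_part la j by rewrite -nth_gt_count.
have cN : conj_part la j <= N by apply: leq_trans zla; apply: count_size.
rewrite nth_betas; last lia.
rewrite /hook; split; first lia.
apply/negP => /mapP[k]; rewrite mem_iota => /andP[_ kN] E.
(* Rows k < la'_j have beta numbers above N + j - la'_j, all later rows have smaller ones. *)
have := nth_gt_count k j sla; have [kc|kc] := ltnP k (conj_part la j); lia.
Qed.

(** Converse of [hook_gap]. If k is the last row whose beta number exceeds the gap v, the column j =
    v + k + 1 - N has la'_j = k + 1, and its hook in row i is the required difference. *)
Lemma gap_hook N la i v : sorted geq la -> size la <= N -> i < N ->
  v < nth 0 (betas N la) i -> v \notin betas N la ->
  exists2 j, j < nth 0 la i & hook la i j = nth 0 (betas N la) i - v.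
Proof.
move=> sla zla iN vi vX.
pose P k := (k < N) && (v < nth 0 (betas N la) k).
have exP : exists k, P k by exists i; apply/andP.
have bP k : P k -> k <= N by case/andP => /ltnW.
case: (ex_maxnP exP bP) => k /andP[kN vk] kmax.
have ik : i <= k by apply: kmax; apply/andP.
have vk1 : k.+1 < N -> nth 0 (betas N la) k.+1 < v.
  move=> k1N; rewrite ltn_neqAle; apply/andP; split.
    by apply: contra vX => /eqP <-; apply: mem_nth; rewrite size_betas.
  rewrite leqNgt; apply/negP => H.
  by have := kmax k.+1; rewrite /P k1N H => /(_ isT); rewrite ltnn.
(* This makes the subtraction defining the column genuine: either k is the last row, or the next
   beta number, at least N - k - 2, is below v. *)
have Nv : N <= v + k.+1.
  have [k1N|] := ltnP k.+1 N; last lia.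
  by have := vk1 k1N; rewrite nth_betas //; lia.
rewrite nth_betas // in vk.
have cE : conj_part la (v + k.+1 - N) = k.+1.
  apply/eqP; rewrite eqn_leq; apply/andP; split; last first.
    by rewrite -nth_gt_count //; lia.
  rewrite leqNgt -nth_gt_count // -leqNgt.
  have [k1N|k1N] := ltnP k.+1 N; last by rewrite nth_default //; lia.
  by have := vk1 k1N; rewrite nth_betas //; lia.
have jl : v + k.+1 - N < nth 0 la i by rewrite nth_gt_count // cE.
by exists (v + k.+1 - N) => //; rewrite /hook cE nth_betas //; lia.
Qed.

Lemma nth_le_sumn la i : nth 0 la i <= sumn la.
Proof.
elim: la i => [|l la IH] [|i] //=; first exact: leq_addr.
exact: leq_trans (IH i) (leq_addl _ _).
Qed.

Lemma size_le_sumn la : 0 \notin la -> size la <= sumn la.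
Proof.
elim: la => //= l la IH; rewrite in_cons negb_or eq_sym -lt0n => /andP[l0 /IH].
by rewrite -add1n; apply: leq_add.
Qed.

Lemma mem_betas_lt N la x : x \in betas N la -> x < N + sumn la.
Proof.
case/mapP => i; rewrite mem_iota => /andP[_ iN] ->.
by have := nth_le_sumn la i; lia.
Qed.

(** The padding zeros fill the positions 0, ..., N - [size la] - 1. *)
Lemma mem_betas_low N la x : x < N - size la -> x \in betas N la.
Proof.
move=> H; apply/mapP; exists (N - x.+1); first by rewrite mem_iota; lia.
by rewrite nth_default; lia.
Qed.

(** * The core criterion *)

Definition flush (t : nat) (X : seq nat) : Prop :=
  forall x, x \in X -> t <= x -> x - t \in X.

Lemma flush_mul t X k x : flush t X -> x \in X -> t * k <= x -> x - t * k \in X.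
Proof.
move=> fX; elim: k => [|k IH] xX H; first by rewrite muln0 subn0.
by rewrite mulnSr subnDA; apply: fX; [apply: IH => //|]; lia.
Qed.

(** The hooks of row i are the differences x - v between its beta number x and the gaps v below. A
    gap at x - t gives a hook t; a hook t k gives a gap at x - t k, which [flush_mul] forbids. *)
Lemma coreP t N la : 0 < t -> sorted geq la -> size la <= N ->
  reflect (flush t (betas N la)) (is_core t la).
Proof.
move=> t0 sla zla; apply: (iffP allP) => [core x|fl i].
  case/(nthP 0) => i; rewrite size_betas => iN <- {x} tx; apply: contraT => H.
  have xlt : nth 0 (betas N la) i - t < nth 0 (betas N la) i.
    by rewrite ltn_subrL t0 (leq_trans t0).
  have [j jl hE] := gap_hook sla zla iN xlt H.
  have il : i < size la by apply: nth_gt_size jl.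
  have := core i; rewrite mem_iota il => /(_ isT)/allP/(_ j).
  by rewrite mem_iota jl hE subKn // dvdnn => /(_ isT).
rewrite mem_iota => /andP[_ il]; apply/allP => j; rewrite mem_iota => /andP[_ jl].
have [/andP[_ hle] hX] := hook_gap sla zla jl.
apply: contra hX => /dvdnP[k hE]; rewrite hE mulnC; apply: flush_mul => //.
  by apply: mem_nth; rewrite size_betas (leq_trans il).
by rewrite mulnC -hE.
Qed.

(** * The abacus with t runners *)

Lemma big_nat_mul_mod (R : Type) (idx : R) (op : Monoid.com_law idx)
    (t K : nat) (F : nat -> R) :
  \big[op/idx]_(0 <= i < t * K) F i =
  \big[op/idx]_(r < t) \big[op/idx]_(0 <= y < K) F (r + t * y).
Proof.
elim: K => [|K IH].
  by rewrite muln0 big_nil big1 // => r _; rewrite big_nil.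
rewrite mulnS addnC (big_cat_nat (n := t * K)) ?leq_addr //= IH.
rewrite -{1}[t * K]add0n big_addn addKn big_mkord -big_split /=.
by apply: eq_bigr => r _; rewrite big_nat_recr.
Qed.

(** Position r + t y is height y on runner r. The list is decreasing, to match [betas], and is cut
    at t K so that runner lengths range over a finite type. *)
Definition abacus (t : nat) (ht : 0 < t) (K : nat) (c : 'I_t -> nat) : seq nat :=
  [seq x <- rev (iota 0 (t * K)) | x %/ t < c (Ordinal (ltn_pmod x ht))].

(** The energy of a configuration: the sum of the bead positions r + t y over y < c r, in closed
    form. *)
Definition abacus_sum (t : nat) (c : 'I_t -> nat) : nat :=
  \sum_(r < t) (r * c r + t * 'C(c r, 2)).

Section Abacus.
Variables (t : nat) (ht : 0 < t) (K : nat).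
Implicit Type c : 'I_t -> nat.

Lemma runner_pos (r : 'I_t) y : (r + t * y) %/ t = y.
Proof. by rewrite addnC mulnC divnMDl // divn_small ?addn0. Qed.

Lemma runner_index (r : 'I_t) y : Ordinal (ltn_pmod (r + t * y) ht) = r.
Proof. by apply: val_inj; rewrite /= addnC mulnC modnMDl modn_small. Qed.

Lemma sorted_abacus c : sorted gtn (abacus ht K c).
Proof.
apply: sorted_filter; first by move=> y x z /= xy yz; apply: ltn_trans xy.
by rewrite rev_sorted; apply: iota_ltn_sorted.
Qed.

Lemma mem_abacus c x : (forall r, c r <= K) ->
  (x \in abacus ht K c) = (x %/ t < c (Ordinal (ltn_pmod x ht))).
Proof.
move=> cK; rewrite mem_filter mem_rev mem_iota add0n leq0n /=.
by case: ltnP => //= H; rewrite mulnC -ltn_divLR // (leq_trans H).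
Qed.

Lemma mem_abacus_runner c (r : 'I_t) y : (forall r, c r <= K) ->
  (r + t * y \in abacus ht K c) = (y < c r).
Proof. by move=> cK; rewrite mem_abacus // runner_pos runner_index. Qed.

Lemma big_abacus c (F : nat -> nat) : (forall r, c r <= K) ->
  \sum_(x <- abacus ht K c) F x = \sum_(r < t) \sum_(0 <= y < c r) F (r + t * y).
Proof.
move=> cK; rewrite big_filter (perm_big (iota 0 (t * K))) /=; last first.
  by rewrite perm_rev.
rewrite -{1}[t * K]subn0 big_mkcond big_nat_mul_mod; apply: eq_bigr => r _.
rewrite (big_nat_widen _ _ _ _ _ (cK r)) [RHS]big_mkcond /=.
by apply: eq_bigr => y _; rewrite runner_pos runner_index.
Qed.

Lemma size_abacus c : (forall r, c r <= K) ->
  size (abacus ht K c) = \sum_(r < t) c r.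
Proof.
move=> cK; rewrite -sum1_size big_abacus //.
by apply: eq_bigr => r _; rewrite sum_nat_const_nat subn0 muln1.
Qed.

Lemma sumn_abacus c : (forall r, c r <= K) ->
  sumn (abacus ht K c) = abacus_sum c.
Proof.
move=> cK; rewrite sumnE big_abacus //; apply: eq_bigr => r _.
rewrite big_split /= sum_nat_const_nat subn0 mulnC; congr (_ + _).
by rewrite -big_distrr /= -triangular_sum.
Qed.

Lemma abacus_inj c d : (forall r, c r <= K) -> (forall r, d r <= K) ->
  abacus ht K c =i abacus ht K d -> forall r, c r = d r.
Proof.
move=> cK dK E r; apply/eqP; rewrite eqn_leq; apply/andP.
have H y : (y < c r) = (y < d r) by rewrite -!mem_abacus_runner // E.
by split; rewrite leqNgt; [rewrite H ltnn | rewrite -H ltnn].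
Qed.

Lemma flush_abacus c : (forall r, c r <= K) -> flush t (abacus ht K c).
Proof.
move=> cK x; rewrite !mem_abacus // => xc tx.
rewrite (_ : Ordinal (ltn_pmod (x - t) ht) = Ordinal (ltn_pmod x ht)).
  by apply: leq_ltn_trans xc; apply: leq_div2r; apply: leq_subr.
by apply: val_inj; rewrite /= -{2}(subnK tx) modnDr.
Qed.

(** The lowest empty height on runner r; [find] returns K if there is none below K. *)
Definition runner (X : seq nat) (r : 'I_t) : nat :=
  find (fun y => r + t * y \notin X) (iota 0 K).

Lemma runner_le X r : runner X r <= K.
Proof. by apply: leq_trans (find_size _ _) _; rewrite size_iota. Qed.

(** Below its first gap a runner is full by minimality; a bead above that gap could be moved down by
    multiples of t into it, against closure. *)
Lemma abacus_runner X : sorted gtn X -> flush t X ->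
  {in X, forall x, x < t * K} -> abacus ht K (runner X) = X.
Proof.
move=> sX fX bX.
apply: (@irr_sorted_eq _ gtn _ _ _ _ (sorted_abacus _) sX).
- by move=> y x z /= xy yz; apply: ltn_trans xy.
- by move=> x /=; rewrite ltnn.
move=> x; rewrite mem_abacus; last exact: runner_le.
set r := Ordinal _; have xE : x = r + t * (x %/ t) by rewrite /= addnC mulnC -divn_eq.
apply/idP/idP => [H|xX].
  have yK : x %/ t < K by apply: leq_trans (runner_le X r).
  have := before_find 0 H; rewrite nth_iota // add0n -xE.
  by move=> /negbFE.
have yK : x %/ t < K by rewrite ltn_divLR // mulnC; apply: bX.
rewrite ltnNge; apply/negP => H.
have fK : runner X r < K by apply: leq_ltn_trans yK.
have hP : has (fun y => r + t * y \notin X) (iota 0 K).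
  by rewrite has_find size_iota.
have /negP := nth_find 0 hP; apply; rewrite -/(runner X r) nth_iota // add0n.
have -> : r + t * runner X r = x - t * (x %/ t - runner X r).
  have tf : t * runner X r <= t * (x %/ t) by rewrite leq_mul2l H orbT.
  have aux a b p z : z = p + a -> b <= a -> p + b = z - (a - b) by lia.
  by rewrite mulnBr; apply: aux.
apply: flush_mul => //; apply: leq_trans (leq_trunc_div x t).
by rewrite mulnC leq_mul2r leq_subr orbT.
Qed.

Lemma abacus_betas c : (forall r, c r <= K) ->
  exists2 la, [/\ sorted geq la, 0 \notin la & size la <= \sum_(r < t) c r]
    & betas (\sum_(r < t) c r) la = abacus ht K c.
Proof.
by move=> cK; have := betas_surj (sorted_abacus c); rewrite size_abacus.
Qed.

(** The excess over the triangular number is the size of the partition that the configuration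
    encodes. *)
Lemma abacus_sum_ge c : (forall r, c r <= K) ->
  'C(\sum_(r < t) c r, 2) <= abacus_sum c.
Proof.
move=> cK; have [la [_ _ sla] E] := abacus_betas cK.
by rewrite -sumn_abacus // -E sumn_betas // leq_addl.
Qed.

(* A configuration of N beads of low energy fills all the positions below
   N - n and none from N + n on, so no runner is nearly empty or full. *)
Lemma abacus_balanced c n : (forall r, c r <= K) ->
  t.+1 * n <= \sum_(r < t) c r -> \sum_(r < t) c r + t.+1 * n <= t * K ->
  abacus_sum c <= 'C(\sum_(r < t) c r, 2) + n ->
  forall r, (n <= c r) && (n <= K - c r).
Proof.
move=> cK; set N := \sum_(r < t) c r => nN NK; rewrite -sumn_abacus // => H r.
have [la [sla l0 zla] E] := abacus_betas cK.
rewrite -/N in zla E; rewrite -E sumn_betas // addnC leq_add2l in H.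
have zn : size la <= n by apply: leq_trans (size_le_sumn l0) H.
have rt := ltn_ord r.
apply/andP; split; rewrite leqNgt; apply/negP => B.
  have : r + t * c r \in betas N la by apply: mem_betas_low; nia.
  by rewrite E mem_abacus_runner // ltnn.
have c0 : 0 < c r.
  rewrite lt0n; apply/eqP => c0; move: B; rewrite c0 subn0 => Kn.
  by have := leq_mul (leqnn t) (ltnW Kn); nia.
have : r + t * (c r).-1 \in betas N la by rewrite E mem_abacus_runner // prednK.
by move/mem_betas_lt; have := cK r; nia.
Qed.

(** A core goes to the runner lengths of its beta-set. The bound m <= N leaves room for all parts,
    and N + m <= t K keeps all beta numbers on the abacus. *)
Lemma num_cores_abacus N m : m <= N -> N + m <= t * K ->
  num_cores t m = #|[set c : {ffun 'I_t -> 'I_K.+1} |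
     (\sum_(r < t) c r == N) && (abacus_sum (fun r : 'I_t => c r) == 'C(N, 2) + m)]|.
Proof.
move=> mN NK; rewrite /num_cores; set A := [set s | _].
pose la (s : m.-bseq 'I_m.+1) := [seq val p | p <- s].
pose cf (s : m.-bseq 'I_m.+1) : {ffun 'I_t -> 'I_K.+1} :=
  [ffun r => inord (runner (betas N (la s)) r)].
have cfE s r : cf s r = runner (betas N (la s)) r :> nat.
  by rewrite ffunE inordK // ltnS runner_le.
have cK (c : {ffun 'I_t -> 'I_K.+1}) r : c r <= K by rewrite -ltnS.
have zl s : size (la s) <= N.
  by rewrite size_map; apply: leq_trans (size_bseq s) mN.
have eqab (c d : 'I_t -> nat) : c =1 d -> abacus ht K c = abacus ht K d.
  by move=> E; apply: eq_filter => x; rewrite E.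
have AP s : s \in A -> [/\ sorted geq (la s), 0 \notin la s, sumn (la s) = m
                         & abacus ht K (fun r => cf s r) = betas N (la s)].
  rewrite inE /= -/(la s) => /andP[/and3P[sl l0 /eqP lm] core]; split=> //.
  rewrite (eqab _ _ (cfE s)); apply: abacus_runner; first exact: sorted_betas.
    exact/(coreP ht sl (zl s)).
  by move=> x /mem_betas_lt; rewrite lm => /leq_trans; apply.
have cfI : {in A &, injective cf}.
  move=> s s' /AP[sl l0 lm E] /AP[sl' l0' lm' E'] cE.
  rewrite cE E' in E; apply/val_inj/(inj_map val_inj).
  exact/esym/(betas_inj (zl s') (zl s) l0' l0 E).
rewrite -(card_in_imset cfI); apply: eq_card => c; rewrite inE.
apply/imsetP/andP => [[s /AP[sl l0 lm E] ->]|[/eqP cN /eqP cm]].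
  rewrite -(size_abacus (cK (cf s))) -(sumn_abacus (cK (cf s))) E size_betas.
  by rewrite sumn_betas // lm addnC !eqxx.
have [mu [smu mu0 zmu] E] := abacus_betas (cK c).
rewrite cN in zmu E.
have mum : sumn mu = m.
  by apply/eqP; rewrite -(eqn_add2r 'C(N, 2)) -sumn_betas // E sumn_abacus // cm addnC.
(* The decoded partition mu has size m, so its parts and its length are at most m and it fits the
   bounded sequence type. *)
pose s0 : seq 'I_m.+1 := map inord mu.
have s0E : map val s0 = mu.
  rewrite -map_comp -[RHS]map_id; apply/eq_in_map => x /(nthP 0)[i _ <-] /=.
  by rewrite inordK // ltnS -mum nth_le_sumn.
have s0m : size s0 <= m by rewrite size_map -mum size_le_sumn.
pose s := Bseq s0m; have lasE : la s = mu by rewrite /la /= s0E.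
have sA : s \in A.
  rewrite inE /= s0E /is_partition smu mu0 mum eqxx /=.
  by apply/(coreP ht smu zmu); rewrite E; apply: flush_abacus.
exists s => //; apply/ffunP => r; apply: val_inj.
apply: (abacus_inj (cK c) (cK (cf s))) => x.
by have [_ _ _ ->] := AP _ sA; rewrite lasE E.
Qed.

End Abacus.

Import GRing.Theory.
Local Open Scope ring_scope.

(** * Congruence modulo ['X^N] and logarithmic derivatives *)

Definition eqX (R : nzRingType) (N : nat) (p q : {poly R}) : Prop :=
  forall i, (i < N)%N -> p`_i = q`_i.

Section EqX.
Variables (R : comNzRingType) (N : nat).
Implicit Types p q : {poly R}.

Lemma eqX_refl p : eqX N p p. Proof. by []. Qed.

Lemma eqX_sym p q : eqX N p q -> eqX N q p.
Proof. by move=> H i /H. Qed.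

Lemma eqX_trans q p r : eqX N p q -> eqX N q r -> eqX N p r.
Proof. by move=> H1 H2 i iN; rewrite H1 ?H2. Qed.

Lemma eqXD p p' q q' : eqX N p p' -> eqX N q q' -> eqX N (p + q) (p' + q').
Proof. by move=> H1 H2 i iN; rewrite !coefD H1 ?H2. Qed.

Lemma eqXB p p' q q' : eqX N p p' -> eqX N q q' -> eqX N (p - q) (p' - q').
Proof. by move=> H1 H2 i iN; rewrite !coefB H1 ?H2. Qed.

Lemma eqXM p p' q q' : eqX N p p' -> eqX N q q' -> eqX N (p * q) (p' * q').
Proof.
move=> H1 H2 i iN; rewrite !coefM; apply: eq_bigr => -[j ji] _ /=.
by rewrite H1 ?H2 //; apply: leq_ltn_trans iN; rewrite ?leq_subr.
Qed.

Lemma eqX_sum (I : finType) (P : pred I) (F G : I -> {poly R}) :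
  (forall i, P i -> eqX N (F i) (G i)) ->
  eqX N (\sum_(i | P i) F i) (\sum_(i | P i) G i).
Proof. by move=> H; apply: (big_ind2 (eqX N)) => //; apply: eqXD. Qed.

Lemma eqX_prod (I : finType) (P : pred I) (F G : I -> {poly R}) :
  (forall i, P i -> eqX N (F i) (G i)) ->
  eqX N (\prod_(i | P i) F i) (\prod_(i | P i) G i).
Proof. by move=> H; apply: (big_ind2 (eqX N)) => //; apply: eqXM. Qed.

Lemma eqX_MXn p m : (N <= m)%N -> eqX N ('X^m * p) 0.
Proof. by move=> Nm i iN; rewrite coefXnM coef0 (leq_trans iN). Qed.

(** A polynomial with constant term 1 is invertible as a power series; strong induction on the
    coefficient avoids constructing the inverse. *)
Lemma eqX_cancel (f p q : {poly R}) : f`_0 = 1 -> eqX N (f * p) (f * q) -> eqX N p q.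
Proof.
move=> f0 H; elim/ltn_ind => i IH iN; have := H i iN.
rewrite !coefM !big_ord_recl /= f0 !mul1r !subn0.
rewrite (eq_bigr (fun j : 'I_i => f`_(lift ord0 j) * q`_(i - lift ord0 j))).
  exact: addIr.
move=> j _; rewrite IH //; first by rewrite ltn_subrL (leq_ltn_trans _ (ltn_ord j)).
by apply: leq_ltn_trans iN; apply: leq_subr.
Qed.

Lemma coef_exp_small p i k : p`_0 = 0 -> (i < k)%N -> (p ^+ k)`_i = 0.
Proof.
move=> p0; elim: k i => // k IH i ik; rewrite exprS coefM big_ord_recl p0 mul0r add0r.
by rewrite big1 // => j _; rewrite IH ?mulr0 //= /bump /=; have := ltn_ord j; lia.
Qed.

(** A product of n + 1 factors without constant term has order above n. This disposes of the
    truncation errors of exp and log. *)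
Lemma coefM_exp_small q p n i : q`_0 = 0 -> p`_0 = 0 -> (i <= n)%N ->
  (q * p ^+ n)`_i = 0.
Proof.
move=> q0 p0 iN; rewrite coefM big_ord_recl q0 mul0r add0r big1 // => j _.
rewrite coef_exp_small ?mulr0 //; apply: leq_trans iN.
by rewrite ltn_subrL (leq_ltn_trans _ (ltn_ord j)).
Qed.

Lemma coefXderiv p i : ('X * p^`())`_i = p`_i *+ i.
Proof. by case: i => [|i]; rewrite coefXM //= coef_deriv. Qed.

Lemma eqX_Xderiv p q : eqX N p q -> eqX N ('X * p^`()) ('X * q^`()).
Proof. by move=> H i iN; rewrite !coefXderiv H. Qed.

(** A division-free form of a = q p' / p. The operator q d/dq, unlike d/dq, respects congruence
    modulo ['X^N]. *)
Definition logder a p := eqX N ('X * p^`()) (a * p).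

Lemma logder_eqX a a' p p' : eqX N a a' -> eqX N p p' ->
  logder a p -> logder a' p'.
Proof.
move=> Ha Hp H; apply: eqX_trans (eqXM Ha Hp).
by apply: eqX_trans H; apply: eqX_Xderiv; apply: eqX_sym.
Qed.

Lemma logderM a b p q : logder a p -> logder b q -> logder (a + b) (p * q).
Proof.
move=> Hp Hq; rewrite /logder derivM.
have -> : 'X * (p^`() * q + p * q^`()) = ('X * p^`()) * q + p * ('X * q^`()) by ring.
have -> : (a + b) * (p * q) = (a * p) * q + p * (b * q) by ring.
by apply: eqXD; apply: eqXM.
Qed.

Lemma logder1 : logder 0 1.
Proof. by rewrite /logder -polyC1 derivC mulr0 mul0r. Qed.

Lemma logder_prod (I : Type) (s : seq I) (a p : I -> {poly R}) :
  (forall i, logder (a i) (p i)) ->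
  logder (\sum_(i <- s) a i) (\prod_(i <- s) p i).
Proof.
move=> H; apply: (big_ind2 logder) => //; first exact: logder1.
by move=> *; apply: logderM.
Qed.

Lemma logderX a p k : logder a p -> logder (a *+ k) (p ^+ k).
Proof.
move=> H; elim: k => [|k IH]; first by rewrite mulr0n expr0; apply: logder1.
by rewrite mulrS exprS; apply: logderM.
Qed.

Lemma logder_div a b p q : q`_0 = 1 ->
  logder b q -> logder a (p * q) -> logder (a - b) p.
Proof.
move=> q0 Hq H; apply: (eqX_cancel q0).
have -> : q * ('X * p^`()) = 'X * (p * q)^`() - p * ('X * q^`()).
  by rewrite derivM; ring.
have -> : q * ((a - b) * p) = a * (p * q) - p * (b * q) by ring.
by apply: eqXB => //; apply: eqXM.
Qed.

(** The geometric series of - j q^j / (1 - q^j), cut after M terms; the error has order j (M + 1) >=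
    N. *)
Lemma logder_1subXn j M : (0 < j)%N -> (N <= M.+1)%N ->
  logder (- \sum_(k < M) j%:R * 'X^(j * k.+1)) (1 - 'X^j).
Proof.
move=> j0 NM; rewrite /logder derivB -polyC1 derivC derivXn sub0r polyC1.
have E : \sum_(k < M) j%:R * 'X^(j * k.+1) =
    j%:R * 'X^j * \sum_(k < M) 'X^j ^+ k :> {poly R}.
  by rewrite mulr_sumr; apply: eq_bigr => k _; rewrite exprM exprS mulrA.
have -> : - (\sum_(k < M) j%:R * 'X^(j * k.+1)) * (1 - 'X^j) =
    j%:R * 'X^j * (('X^j - 1) * \sum_(k < M) 'X^j ^+ k) :> {poly R}.
  by rewrite E; ring.
rewrite -subrX1 -exprM.
have -> : 'X * - ('X^(j.-1) *+ j) = 0 - j%:R * 'X^j :> {poly R}.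
  by case: j j0 {E} => // j _; rewrite mulrN mulrnAr -exprS sub0r mulr_natl.
have -> : j%:R * 'X^j * ('X^(j * M) - 1) =
    'X^(j * M.+1) * j%:R - j%:R * 'X^j :> {poly R} by rewrite mulnS exprD; ring.
apply: eqXB => //; apply/eqX_sym/eqX_MXn; exact: leq_trans NM (leq_pmull _ j0).
Qed.

End EqX.

(** Since a has no constant term, i times the i-th coefficient is determined by the lower
    coefficients, and i > 0 is invertible in the rationals. *)
Lemma logder_unique (N : nat) (a p q : {poly rat}) : a`_0 = 0 -> p`_0 = q`_0 ->
  logder N a p -> logder N a q -> eqX N p q.
Proof.
move=> a0 pq0 Hp Hq; elim/ltn_ind => -[|i] IH iN //.
have := Hp _ iN; have := Hq _ iN; rewrite !coefXderiv !coefM !(big_ord_recl i.+1) a0 !mul0r !add0r.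
move=> E1 E2.
have {}E1 : q`_i.+1 *+ i.+1 = p`_i.+1 *+ i.+1.
  rewrite E1 E2; apply: eq_bigr => j _; rewrite IH //.
    by rewrite ltn_subrL.
  by apply: leq_ltn_trans iN; apply: leq_subr.
apply: (@mulIf _ i.+1%:R); first by rewrite Num.Theory.pnatr_eq0.
by rewrite !mulr_natr.
Qed.

(** * Gaussian binomials *)

Fixpoint qbin (R : comNzRingType) (Q : R) (K c : nat) : R :=
  match K, c with
  | 0, 0 => 1
  | 0, _.+1 => 0
  | _.+1, 0 => 1
  | K'.+1, c'.+1 => qbin Q K' c'.+1 + Q ^+ (K' - c') * qbin Q K' c'
  end.

(** The q-Pochhammer symbol (Q; Q)_m. *)
Definition qpoch (R : comNzRingType) (Q : R) (m : nat) : R :=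
  \prod_(i < m) (1 - Q ^+ i.+1).

Section QBin.
Variable R : comNzRingType.
Implicit Types Q u : R.

Lemma qbin0 Q K : qbin Q K 0 = 1. Proof. by case: K. Qed.

Lemma qbin_small Q K c : (K < c)%N -> qbin Q K c = 0.
Proof.
elim: K c => [|K IH] [|c] //= Kc; rewrite !IH ?mulr0 ?addr0 //.
exact: ltnW.
Qed.

(** The q-binomial theorem, by induction on the number of factors. The parameter u is there to
    become q^r on runner r. *)
Lemma coef_qbinomial Q u K i :
  (\prod_(0 <= x < K) (1 + (u * Q ^+ x) *: 'X))`_i =
  u ^+ i * Q ^+ 'C(i, 2) * qbin Q K i.
Proof.
elim: K i => [|K IH] i.
  by rewrite big_nil coef1; case: i => [|i] /=; rewrite ?mulr0 // !expr0 !mulr1.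
rewrite big_nat_recr //= mulrDr mulr1 -scalerAr coefD coefZ coefMX !IH.
case: i => [|i] /=; first by rewrite qbin0 mulr0 addr0.
have [iK|Ki] := leqP i K; last by rewrite !qbin_small ?(leqW Ki) //; ring.
by rewrite binS bin1 exprD exprS -{2}(subnK iK) exprD; ring.
Qed.

Lemma qbinE Q c d : qbin Q (c + d) c * qpoch Q c * qpoch Q d = qpoch Q (c + d).
Proof.
have pS m : qpoch Q m.+1 = qpoch Q m * (1 - Q ^+ m.+1).
  by rewrite /qpoch big_ord_recr.
have p0 : qpoch Q 0 = 1 by rewrite /qpoch big_ord0.
have [K] := ubnP (c + d); elim: K c d => // K IH [|c] d; first by rewrite qbin0 p0 !mul1r.
rewrite addSn ltnS /= => cdK; rewrite addKn.
case: d cdK => [|d] cdK.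
  have := IH c 0%N cdK; rewrite !addn0 p0 mulr1 expr0 mul1r => E.
  by rewrite qbin_small ?add0r // !pS mulr1 mulrA E.
have E1 := IH c d.+1 cdK; have := IH c.+1 d; rewrite addSn -addnS => /(_ cdK) E2.
rewrite [in RHS]pS.
have -> : Q ^+ (c + d.+1).+1 = Q ^+ d.+1 * Q ^+ c.+1 by rewrite -exprD; congr (_ ^+ _); lia.
(* This splits 1 - Q^(c+d+2) as (1 - Q^(d+1)) + Q^(d+1) (1 - Q^(c+1)), one summand for each term of
   the Pascal rule. *)
transitivity (qbin Q (c + d.+1) c.+1 * qpoch Q c.+1 * qpoch Q d * (1 - Q ^+ d.+1)
   + Q ^+ d.+1 * (1 - Q ^+ c.+1) * (qbin Q (c + d.+1) c * qpoch Q c * qpoch Q d.+1)).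
  by rewrite !pS; ring.
by rewrite E1 E2; ring.
Qed.

(** Distributivity: f chooses one exponent in each factor. It serves both the dissection over
    runners and the multinomial formula. *)
Lemma coef_prod_poly (t M N : nat) (a : 'I_t -> nat -> R) :
  (\prod_(r < t) \poly_(c < M) a r c)`_N =
  \sum_(f : {ffun 'I_t -> 'I_M} | (\sum_(r < t) f r == N)%N) \prod_(r < t) a r (f r).
Proof.
under eq_bigr do rewrite poly_def.
rewrite bigA_distr_bigA coef_sum [RHS]big_mkcond /=; apply: eq_bigr => f _.
rewrite scaler_prod coefZ -expr_sum coefXn eq_sym.
by case: eqP; rewrite ?mulr1 ?mulr0.
Qed.

End QBin.

Section QBinSeries.
Variable R : comNzRingType.

Lemma qpoch_coef0 s n : (0 < s)%N -> (qpoch ('X^s : {poly R}) n)`_0 = 1.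
Proof.
move=> s0; rewrite -horner_coef0 horner_prod big1 // => i _.
by rewrite -exprM !hornerE expr0n muln_eq0 /= -leqn0 leqNgt s0 subr0.
Qed.

Lemma qpoch_eqX s n m : (0 < s)%N -> (n <= m)%N ->
  eqX n.+1 (qpoch ('X^s : {poly R}) m) (qpoch 'X^s n).
Proof.
move=> s0 /subnKC <-; elim: (m - n)%N => [|d IH]; first by rewrite addn0.
rewrite addnS /qpoch big_ord_recr /= -/(qpoch _ _).
rewrite -[X in eqX _ _ X]mulr1 -[X in eqX _ _ (_ * X)]subr0.
apply: eqXM IH _; apply: eqXB => //; rewrite -exprM -[X in eqX _ X]mulr1.
by apply: eqX_MXn; apply: leq_trans (leq_pmull _ s0); rewrite ltnS leq_addr.
Qed.

(** In [qbinE] the Pochhammer symbols of lengths c, K - c and K all agree with that of length n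
    modulo ['X^(n+1)], and one copy cancels. *)
Lemma qbin_eqX s n K c : (0 < s)%N -> (n <= c)%N -> (n <= K - c)%N -> (c <= K)%N ->
  eqX n.+1 (qbin ('X^s : {poly R}) K c * qpoch 'X^s n) 1.
Proof.
move=> s0 nc nKc cK; apply: (eqX_cancel (qpoch_coef0 n s0)); rewrite mulr1.
apply: eqX_trans (qpoch_eqX s0 (leq_trans nc cK)).
have := qbinE ('X^s : {poly R}) c (K - c); rewrite subnKC // => <-.
rewrite mulrC; apply: eqXM; last by apply/eqX_sym/qpoch_eqX.
by apply: eqXM => //; apply/eqX_sym/qpoch_eqX.
Qed.

(* Comparing the coefficients of z^N in
   prod_(i < t K) (1 + z q^i) = prod_(r < t) prod_(y < K) (1 + z q^(r + t y)). *)
Lemma qbin_dissection (t K N : nat) :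
  'X^'C(N, 2) * qbin 'X (t * K) N =
  \sum_(c : {ffun 'I_t -> 'I_K.+1} | (\sum_(r < t) c r == N)%N)
     'X^(abacus_sum (fun r : 'I_t => c r)) * \prod_(r < t) qbin 'X^t K (c r)
  :> {poly R}.
Proof.
(* Polynomials over [{poly R}]: the outer variable is z, the inner one is q. *)
have := coef_qbinomial ('X : {poly R}) 1 (t * K) N.
rewrite expr1n mul1r => <-; rewrite big_nat_mul_mod.
rewrite (eq_bigr (fun r : 'I_t => \poly_(c < K.+1)
    ('X^(r * c + t * 'C(c, 2)) * qbin 'X^t K c : {poly R}))); last first.
  move=> r _; apply/polyP => i; rewrite coef_poly.
  rewrite (eq_bigr (fun y => 1 + ('X^r * 'X^t ^+ y) *: 'X)); last first.
    by move=> y _; rewrite mul1r exprD exprM.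
  rewrite coef_qbinomial -!exprM -exprD; case: ltnP => // Ki.
  by rewrite qbin_small ?mulr0.
rewrite coef_prod_poly; apply: eq_bigr => c _.
by rewrite big_split /= /abacus_sum expr_sum.
Qed.

End QBinSeries.

(** * The generating function of t-cores *)

Definition core_poly (t n : nat) : {poly rat} :=
  \poly_(m < n.+1) (num_cores t m)%:R.

Lemma core_poly_qpoch (t n : nat) : (0 < t)%N ->
  eqX n.+1 (core_poly t n * qpoch 'X n) (qpoch 'X^t n ^+ t).
Proof.
(* These values satisfy the hypotheses of [abacus_balanced]: N = (t + 1) n, and 2 (t + 1) n <= 4 t n
   because t >= 1. *)
move=> ht; pose N := (t.+1 * n)%N; pose K := (4 * n)%N.
have NK : (N + t.+1 * n <= t * K)%N by rewrite /N /K; nia.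
have cK (c : {ffun 'I_t -> 'I_K.+1}) r : (c r <= K)%N by rewrite -ltnS.
pose P (c : {ffun 'I_t -> 'I_K.+1}) := (\sum_(r < t) c r == N)%N.
(* The size of the core encoded by c. *)
pose e (c : {ffun 'I_t -> 'I_K.+1}) := (abacus_sum (fun r : 'I_t => c r) - 'C(N, 2))%N.
have eE c : P c -> abacus_sum (fun r : 'I_t => c r) = ('C(N, 2) + e c)%N.
  by move=> /eqP cN; rewrite subnKC // -cN; apply: abacus_sum_ge (cK c).
have gauss : qbin 'X (t * K) N =
    \sum_(c | P c) 'X^(e c) * \prod_(r < t) qbin 'X^t K (c r) :> {poly rat}.
  apply: (@mulfI _ 'X^'C(N, 2)); first by rewrite -size_poly_eq0 size_polyXn.
  rewrite qbin_dissection mulr_sumr; apply: eq_bigr => c Pc.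
  by rewrite eE // exprD mulrA.
have coreE : eqX n.+1 (core_poly t n) (\sum_(c | P c) 'X^(e c)).
  move=> m mn; rewrite coef_poly mn coef_sum.
  rewrite (num_cores_abacus ht (K := K) (N := N)); last 2 first.
  - by rewrite /N; nia.
  - by apply: leq_trans NK; rewrite leq_add2l; nia.
  rewrite -sum1_card natr_sum [RHS]big_mkcond [LHS]big_mkcond /=.
  apply: eq_bigr => c _; rewrite inE -/(P c); case: (boolP (P c)) => //= Pc.
  by rewrite eE // eqn_add2l coefXn eq_sym; case: eqP.
apply: eqX_trans (eqXM coreE (eqX_refl _)) _.
have one : eqX n.+1 (qbin 'X (t * K) N * qpoch 'X n) (1 : {poly rat}).
  rewrite -[X in qbin X]expr1 -[X in qpoch X]expr1; apply: qbin_eqX => //.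
  - by rewrite /N; nia.
  - by rewrite leq_subRL; nia.
  - by nia.
(* Insert the factor [one], expand the Gaussian binomial by [gauss], and compare termwise. Terms
   with e c > n vanish on both sides; otherwise c is balanced and each runner contributes 1. *)
apply: eqX_sym; rewrite -[X in eqX _ X _]mulr1.
apply: eqX_trans (eqXM (eqX_refl _) (eqX_sym one)) _.
rewrite mulrA; apply: eqXM => //; rewrite gauss mulr_sumr.
apply: eqX_sum => c Pc; rewrite mulrCA.
have [en|en] := leqP (e c) n; last first.
  apply: eqX_trans (eqX_MXn _ en) _; apply: eqX_sym.
  by rewrite -['X^(e c)]mulr1; apply: eqX_MXn.
rewrite -[X in eqX _ _ X]mulr1; apply: eqXM => //.
rewrite -[X in _ ^+ X](card_ord t) -prodr_const -big_split /=.
have one_prod : \prod_(r < t) 1 = 1 :> {poly rat} by rewrite big1_eq.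
rewrite -[X in eqX _ _ X]one_prod.
apply: eqX_prod => r _; rewrite mulrC.
have /andP[] : (n <= c r)%N && (n <= K - c r)%N.
  apply: (abacus_balanced ht (cK c)); rewrite ?(eqP Pc) //.
  by rewrite eE // leq_add2l.
by move=> *; apply: qbin_eqX.
Qed.

(** * Divisor sums as logarithmic derivatives *)

(** Each divisor i + 1 of j is counted once, through its cofactor k + 1; both are at most n. *)
Lemma sigma1_sum (n j : nat) : (0 < j <= n)%N ->
  sigma1 j = (\sum_(i < n) \sum_(k < n) i.+1 * (j == i.+1 * k.+1))%N.
Proof.
move=> /andP[j0 jn]; rewrite /sigma1.
have dE : perm_eq (divisors j) [seq d <- iota 1 n | (d %| j)%N].
  apply: uniq_perm; rewrite ?divisors_uniq ?filter_uniq ?iota_uniq // => d.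
  rewrite mem_filter -dvdn_divisors // mem_iota andbC.
  by case: (boolP (d %| j)%N) => dj; rewrite ?andbF ?andbT //;
    have := dvdn_leq j0 dj; have := dvdn_gt0 j0 dj; lia.
rewrite (perm_big _ dE) big_filter big_mkcond /=.
rewrite -[1%N]addn0 iotaDl big_map -[X in iota _ X]subn0 -/(index_iota 0 n) big_mkord.
apply: eq_bigr => i _; rewrite -big_distrr /= add1n.
case: (boolP (i.+1 %| j)%N) => [/dvdnP[k jE]|ndiv].
  have k0 : (0 < k)%N by rewrite lt0n; apply: contraTneq j0 => k0; rewrite jE k0.
  have kn : (k.-1 < n)%N by rewrite prednK //; apply: leq_trans jn; rewrite jE leq_pmulr.
  rewrite (bigD1 (Ordinal kn)) //= prednK // big1 ?addn0; last first.
    move=> l lk; rewrite jE mulnC eqn_pmul2l //.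
    case: eqP => // kl; case/eqP: lk; apply: val_inj => /=; lia.
  by rewrite jE [(k * _)%N]mulnC eqxx muln1.
rewrite big1 ?muln0 // => k _; case: eqP => // jE; case/negP: ndiv.
by rewrite jE dvdn_mulr.
Qed.

(** A truncation of the Lambert series of s m q^(s m) / (1 - q^(s m)) over m >= 1. *)
Definition sigma_poly (s n : nat) : {poly rat} :=
  \sum_(i < n) \sum_(k < n) (s * i.+1)%:R * 'X^(s * i.+1 * k.+1).

Lemma coef_sigma_poly (s n j : nat) : (0 < s)%N -> (j <= n)%N ->
  (sigma_poly s n)`_j = (s * (if j is 0 then 0 else sigma1_at s j))%:R.
Proof.
move=> s0 jn; rewrite coef_sum.
under eq_bigr do [rewrite coef_sum; under eq_bigr do
  rewrite -polyC_natr coefCM coefXn -natrM].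
under eq_bigr do rewrite -natr_sum.
rewrite -natr_sum; congr _%:R.
case: j jn => [|j] jn.
  rewrite muln0; apply: big1 => i _; apply: big1 => k _.
  by rewrite eq_sym !muln_eq0 /= orbF (gtn_eqF s0) muln0.
rewrite /sigma1_at; case: ifP => sj; last first.
  rewrite muln0; apply: big1 => i _; apply: big1 => k _.
  by case: eqP => [E|]; rewrite ?muln0 //; rewrite E -mulnA dvdn_mulr in sj.
have jsn : (0 < j.+1 %/ s <= n)%N.
  by rewrite divn_gt0 // dvdn_leq //= (leq_trans (leq_div _ _)).
rewrite (sigma1_sum jsn) big_distrr /=; apply: eq_bigr => i _.
rewrite big_distrr /=; apply: eq_bigr => k _; rewrite mulnA.
by rewrite -{1}(divnK sj) [(_ * s)%N]mulnC -[in X in _ == X]mulnA eqn_pmul2l.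
Qed.

Lemma logder_qpoch (s n : nat) : (0 < s)%N ->
  logder n.+1 (- sigma_poly s n) (qpoch 'X^s n).
Proof.
move=> s0; rewrite /sigma_poly -sumrN; apply: logder_prod => i.
by rewrite -exprM; apply: logder_1subXn => //; rewrite muln_gt0 s0.
Qed.

Definition coef_a_poly (t n : nat) : {poly rat} :=
  \poly_(j < n.+1) (if j is 0 then 0 else coef_a t j).

(** Division becomes subtraction, giving [sigma_poly 1 n] minus t times [sigma_poly t n]. One factor
    t of t^2 is the exponent in the product, the other comes from differentiating q^(t i). *)
Lemma logder_core_poly (t n : nat) : (0 < t)%N ->
  logder n.+1 (coef_a_poly t n) (core_poly t n).
Proof.
move=> t0.
have H1 := @logder_qpoch 1 n isT; rewrite expr1 in H1.
have Ht := logderX t (@logder_qpoch t n t0).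
have Hc := logder_eqX (@eqX_refl _ _ _) (eqX_sym (@core_poly_qpoch t n t0)) Ht.
have q0 := @qpoch_coef0 rat 1 n isT; rewrite expr1 in q0.
apply: logder_eqX (@eqX_refl _ _ _) (logder_div q0 H1 Hc) => j jn.
rewrite coefB coefMn !coefN !coef_sigma_poly // coef_poly jn mul1n opprK.
case: j jn => [|j] jn; first by rewrite muln0 oppr0 mul0rn addr0.
rewrite /coef_a addrC {1}/sigma1_at dvd1n divn1; congr (_ + _).
by rewrite mulNrn -mulrnA -natrM; congr (1 *- _); ring.
Qed.

(** * Multinomial expansion of powers *)

Section Multinomial.
Variable A : comAlgType rat.
Implicit Types x y : A.

(** The exponential exp(x z), truncated in an auxiliary variable z. *)
Definition texp (n : nat) x : {poly A} :=
  \poly_(k < n.+1) ((k`!%:R^-1 : rat) *: x ^+ k).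

Lemma factr_neq0 k : k`!%:R != 0 :> rat.
Proof. by rewrite Num.Theory.pnatr_eq0 -lt0n fact_gt0. Qed.

Lemma texp0 n : texp n 0 = 1.
Proof.
apply/polyP => i; rewrite coef_poly coef1 expr0n.
by case: i => [|i] /=; rewrite ?invr1 ?scale1r // scaler0 if_same.
Qed.

Lemma texpD n x y : eqX n.+1 (texp n x * texp n y) (texp n (x + y)).
Proof.
move=> i iN; rewrite coef_poly iN coefM exprDn scaler_sumr.
rewrite [RHS](reindex_inj rev_ord_inj) /=; apply: eq_bigr => -[j ji] _ /=.
rewrite !coef_poly (leq_trans ji iN) (leq_ltn_trans (leq_subr _ _) iN).
rewrite subSS subKn // -scalerAl -scalerAr scalerA -scaler_nat scalerA.
congr (_ *: _); rewrite bin_sub //.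
have := bin_fact (ji : (j <= i)%N) => /(congr1 (fun m => m%:R : rat)); rewrite !natrM => <-.
by rewrite !invfM mulrAC mulVf ?mul1r // Num.Theory.pnatr_eq0 -lt0n bin_gt0.
Qed.

Lemma texp_sum n r (x : 'I_r -> A) :
  eqX n.+1 (\prod_(i < r) texp n (x i)) (texp n (\sum_(i < r) x i)).
Proof.
apply: (big_ind2 (fun p y => eqX n.+1 p (texp n y))); first by rewrite texp0.
  by move=> p y q z Hp Hq; apply: eqX_trans (eqXM Hp Hq) _; apply: texpD.
by [].
Qed.

(** Compare the coefficients of z^k in the product of the exp(x_i z) and in exp((x_1 + ... + x_r)
    z). *)
Lemma multinomial n r (x : 'I_r -> A) k : (k <= n)%N ->
  (k`!%:R^-1 : rat) *: (\sum_(i < r) x i) ^+ k =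
  \sum_(m : {ffun 'I_r -> 'I_n.+1} | (\sum_(i < r) m i == k)%N)
    \prod_(i < r) (((m i)`!%:R^-1 : rat) *: x i ^+ m i).
Proof.
move=> kn; have := @texp_sum n r x k; rewrite ltnS => /(_ kn).
by rewrite coef_prod_poly coef_poly ltnS kn => <-.
Qed.

End Multinomial.

(** Apply [multinomial] to the monomials f(i+1) u^(i+1): the exponent of u selects the partitions of
    n, and k is their length. *)
Lemma coef_exp_multinomial (f : nat -> rat) n k : f 0%N = 0 -> (k <= n)%N ->
  k`!%:R^-1 * ((\poly_(j < n.+1) f j) ^+ k)`_n =
  \sum_(m in mult_partitions n | mult_length m == k)
    \prod_(i < n) ((m i)`!%:R^-1 * f i.+1 ^+ m i).
Proof.
move=> f0 kn.
have -> : \poly_(j < n.+1) f j = \sum_(i < n) f i.+1 *: 'X^(i.+1).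
  by rewrite poly_def big_ord_recl f0 scale0r add0r.
rewrite -coefZ (multinomial _ kn) coef_sum [RHS]big_mkcondl [LHS]big_mkcond /=.
rewrite [RHS]big_mkcond /=; apply: eq_bigr => m _.
rewrite -/(mult_length m) inE; case: ifP => // _.
under eq_bigr do rewrite exprZn scalerA -exprM.
rewrite scaler_prod coefZ -expr_sum coefXn eq_sym.
by case: eqP; rewrite ?mulr1 ?mulr0.
Qed.

Lemma mult_length_le n m : m \in mult_partitions n -> (mult_length m <= n)%N.
Proof.
rewrite inE => /eqP H; rewrite -[X in (_ <= X)%N]H.
by apply: leq_sum => i _; apply: leq_pmull.
Qed.

Lemma sum_mult_partitions n (F : nat -> rat) (G : {ffun 'I_n -> 'I_n.+1} -> rat) :
  \sum_(k < n.+1) F k * \sum_(m in mult_partitions n | mult_length m == k) G m =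
  \sum_(m in mult_partitions n) F (mult_length m) * G m.
Proof.
rewrite [RHS](partition_big (fun m => inord (mult_length m) : 'I_n.+1) predT) //=.
apply: eq_bigr => k _; rewrite mulr_sumr; apply: congr_big => // m.
  case: (boolP (m \in _)) => //= mP; rewrite -val_eqE /= inordK //.
  by rewrite ltnS mult_length_le.
by move=> /andP[_ /eqP ->].
Qed.

Lemma exp_coef_multinomial (f : nat -> rat) n : f 0%N = 0 ->
  exp_coef (f : nat -> rat^o) n =
  \sum_(m in mult_partitions n) \prod_(i < n) ((m i)`!%:R^-1 * f i.+1 ^+ m i).
Proof.
move=> f0; rewrite -[RHS](eq_bigr _ (fun m _ => mul1r _)).
rewrite -(sum_mult_partitions (fun=> 1)); apply: eq_bigr => k _.
by rewrite mul1r -coef_exp_multinomial // -ltnS.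
Qed.

(** * Truncated exponential and logarithm *)

Lemma deriv1 : (1 : {poly rat})^`() = 0.
Proof. by rewrite -polyC1 derivC. Qed.

(** Differentiation drops the top term of the truncated exponential; what is lost, q p' p^n / n!,
    has order above n. *)
Lemma logder_exp n (p : {poly rat}) : p`_0 = 0 ->
  logder n.+1 ('X * p^`()) (\sum_(k < n.+1) k`!%:R^-1 *: p ^+ k).
Proof.
move=> p0; rewrite /logder raddf_sum /=.
have -> : \sum_(k < n.+1) (k`!%:R^-1 *: p ^+ k)^`() =
    p^`() * \sum_(k < n) k`!%:R^-1 *: p ^+ k.
  rewrite big_ord_recl expr0 derivZ deriv1 scaler0 add0r mulr_sumr.
  apply: eq_bigr => k _; rewrite derivZ deriv_exp /= -scalerAr -scaler_nat scalerA.
  congr (_ *: _).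
  by rewrite factS natrM invfM mulrAC mulVf ?mul1r // Num.Theory.pnatr_eq0.
rewrite big_ord_recr /= mulrDr -[X in eqX _ X]addr0 mulrA.
apply: eqXD => //; apply: eqX_sym => i iN.
rewrite coef0 -scalerAr coefZ coefM_exp_small ?mulr0 //.
by rewrite coefXM.
Qed.

(** The sum is log(1 + p) truncated. Its derivative is p' times a geometric sum in -p, and
    multiplying by 1 + p leaves p' up to a multiple of p' p^n. *)
Lemma logder_log n (a p : {poly rat}) : p`_0 = 0 -> logder n.+1 a (1 + p) ->
  eqX n.+1 ('X * (\sum_(k < n) ((-1) ^+ k / k.+1%:R) *: p ^+ k.+1)^`()) a.
Proof.
move=> p0 H; have p1 : (1 + p)`_0 = 1 by rewrite coefD p0 coef1 addr0.
apply: (eqX_cancel p1); rewrite [in X in eqX _ _ X]mulrC; apply: eqX_trans H.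
rewrite derivD deriv1 add0r raddf_sum /=.
have -> : \sum_(k < n) (((-1) ^+ k / k.+1%:R) *: p ^+ k.+1)^`() =
    p^`() * \sum_(k < n) (- p) ^+ k.
  rewrite mulr_sumr; apply: eq_bigr => k _; rewrite derivZ deriv_exp /=.
  rewrite -scaler_nat scalerA divfK ?Num.Theory.pnatr_eq0 //.
  by rewrite -scaleN1r exprZn -scalerAr.
have -> : (1 + p) * ('X * (p^`() * \sum_(k < n) (- p) ^+ k)) =
    'X * p^`() - 'X * p^`() * (((- p) - 1) * \sum_(k < n) (- p) ^+ k + 1).
  ring.
rewrite -subrX1 subrK -[X in eqX _ _ X]subr0.
apply: eqXB => // i iN; rewrite coef0 coefM_exp_small //.
  by rewrite coefXM.
by rewrite coefN p0 oppr0.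
Qed.

(** * The formulas for core numbers *)

Lemma core_poly_coef0 t n : (0 < t)%N -> (core_poly t n)`_0 = 1.
Proof.
move=> t0; have := @core_poly_qpoch t n t0 0%N isT.
have q0 := @qpoch_coef0 rat 1 n isT; rewrite expr1 in q0.
rewrite coef0M q0 mulr1 => ->.
by rewrite -horner_coef0 horner_exp horner_coef0 qpoch_coef0 // expr1n.
Qed.

Lemma num_cores0 t : (0 < t)%N -> (num_cores t 0)%:R = 1 :> rat.
Proof. by move=> t0; have := @core_poly_coef0 t 0 t0; rewrite coef_poly. Qed.

(** Both series have constant term 1 and the logarithmic derivative with coefficients a(j), so
    [logder_unique] applies. *)
Lemma num_cores_exp t n : (0 < t)%N ->
  (num_cores t n)%:R = exp_coef ((fun j => coef_a t j / j%:R) : nat -> rat^o) n.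
Proof.
move=> t0; set f : nat -> rat := fun j => _.
(* Here the convention that the inverse of 0 is 0 removes the constant term. *)
have f0 : f 0%N = 0 by rewrite /f invr0 mulr0.
pose p := \poly_(j < n.+1) f j.
have p0 : p`_0 = 0 by rewrite coef_poly.
have Hc : logder n.+1 ('X * p^`()) (core_poly t n).
  apply: logder_eqX (@eqX_refl _ _ _) (@logder_core_poly t n t0) => j jn.
  rewrite coefXderiv !coef_poly jn; case: j {jn} => [|j]; first by rewrite mulr0n.
  by rewrite -mulr_natr /f divfK // Num.Theory.pnatr_eq0.
have E : eqX n.+1 (core_poly t n) (\sum_(k < n.+1) k`!%:R^-1 *: p ^+ k).
  apply: logder_unique Hc (@logder_exp n p p0); first by rewrite coefXM.
  rewrite core_poly_coef0 // big_ord_recl coefD expr0 invr1 scale1r coef1.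
  by rewrite coef_sum big1 ?addr0 // => k _; rewrite coefZ coef_exp_small // mulr0.
have := E n (ltnSn n); rewrite coef_poly ltnSn => ->.
by rewrite coef_sum; apply: eq_bigr => k _; rewrite coefZ.
Qed.

Theorem mainTheorem4 (t : nat) (ht : (1 <= t)%N) (n : nat) (hn : (1 <= n)%N) :
  [/\ (num_cores t n)%:R
        = n`!%:R^-1 * (bell n).@[fun i : 'I_n => i`!%:R * coef_a t i.+1] :> rat,
      (num_cores t n)%:R
        = \sum_(m in mult_partitions n) \prod_(i < n)
            ((m i)`!%:R^-1 * (coef_a t i.+1 / i.+1%:R) ^+ m i) :> rat
    & coef_a t n
        = n%:R * \sum_(m in mult_partitions n)
            ((-1) ^+ (mult_length m - 1) * (mult_length m - 1)`!%:R
             * \prod_(i < n) ((num_cores t i.+1)%:R ^+ m i / (m i)`!%:R))].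
Proof.
split.
- rewrite num_cores_exp // mulrC.
  rewrite (bell_gf (fun j => (j.-1)`!%:R * coef_a t j)).
  rewrite /exp_coef; set p := \poly_(j < n.+1) _; set q := \poly_(j < n.+1) _.
  suff -> : p = q by [].
  apply/polyP => j; rewrite !coef_poly; case: ifP => // _.
  case: j => [|j] /=; first by rewrite invr0 mulr0.
  (* The weights reduce by (j-1)! a(j) / j! = a(j) / j. *)
  rewrite /GRing.scale /= factS natrM invfM -mulrA mulKf ?factr_neq0 //.
  exact: mulrC.
- rewrite num_cores_exp // exp_coef_multinomial //.
  by rewrite invr0 mulr0.
(* For the converse, subtract the constant term 1 and take the logarithm of 1 + p. *)
pose f j : rat := if j is 0 then 0 else (num_cores t j)%:R.
pose p := \poly_(j < n.+1) f j.
have p0 : p`_0 = 0 by rewrite coef_poly.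
have cE : core_poly t n = 1 + p.
  apply/polyP => j; rewrite coefD coef1 !coef_poly.
  by case: j => [|j] /=; rewrite ?num_cores0 ?addr0 ?add0r.
have := @logder_core_poly t n ht; rewrite cE => /(logder_log p0)/(_ n (ltnSn n)).
rewrite coefXderiv [RHS]coef_poly ltnSn.
case: n hn @p p0 cE => // n _ p p0 cE <-; rewrite -[LHS]mulr_natl; congr (_ * _).
rewrite coef_sum.
(* The logarithm has coefficients (-1)^(k-1) / k = F k / k!, and the 1 / k! is absorbed by
   [coef_exp_multinomial]. *)
pose F k : rat := if k is k'.+1 then (-1) ^+ k' * k'`!%:R else 0.
transitivity (\sum_(k < n.+2) F k * (k`!%:R^-1 * (p ^+ k)`_n.+1)).
  rewrite [RHS]big_ord_recl mul0r add0r; apply: eq_bigr => k _.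
  rewrite coefZ /= factS natrM invfM mulrA; congr (_ * _).
  by rewrite mulrACA divff ?mulr1 // factr_neq0.
rewrite (eq_bigr (fun k : 'I_n.+2 => F k * \sum_(m in mult_partitions n.+1 |
   mult_length m == k) \prod_(i < n.+1) ((m i)`!%:R^-1 * f i.+1 ^+ m i))); last first.
  by move=> k _; rewrite coef_exp_multinomial // -ltnS.
rewrite sum_mult_partitions; apply: eq_bigr => m mP.
(* A partition of a positive integer has a part, so the value F 0 = 0 never occurs and l - 1 is a
   true predecessor. *)
have : mult_length m != 0%N.
  apply: contraTneq mP => /eqP; rewrite inE sum_nat_eq0 => /forallP m0.
  by rewrite big1 // => i _; rewrite (eqP (m0 i)) muln0.
case: (mult_length m) => // l _; rewrite subn1 /=; congr (_ * _).
by apply: eq_bigr => i _; rewrite mulrC.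
Qed.
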